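(* Let $n,n_1,n_2$ be integers with $1\leq n_1<n_2\leq n$ and $5\leq n\leq 8$. Then the prime difference graph $G_n$ is $(n_1,n_2)$-feasible except in the following cases (in which it is not $(n_1,n_2)$-feasible): (i) $n=5$ and $(n_1,n_2)\in\{(1,2),(2,3),(3,4),(4,5),(1,5)\}$; (ii) $n=6$ and $(n_1,n_2)\in\{(2,3),(3,4),(4,5)\}$; (iii) $n=7$ and $(n_1,n_2)\in\{(3,4),(4,5)\}$; (iv) $n=8$ and $(n_1,n_2)=(4,5)$.
   Context: For a positive integer $n$, the prime difference graph $G_n$ of order $n$ is the graph with vertex set $\{1,2,\dots,n\}$ in which two vertices $u,v$ are adjacent if and only if $|u-v|$ is a prime number. A Hamilton path is a path visiting each vertex of the graph exactly once. $G_n$ is called $(n_1,n_2)$-feasible if there exists a Hamilton path in $G_n$ with end-vertices $n_1$ and $n_2$. *)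

(* Defs.v *)
From mathcomp Require Import all_boot all_order all_algebra.
Set Implicit Arguments.
Unset Strict Implicit.
Unset Printing Implicit Defensive.

(* A graph is given by its vertex set [V] and its adjacency relation [e] on an
   ambient type. The path visits [x :: p] in this order. *)
Definition hamilton_path (T : eqType) (V : pred T) (e : rel T)
    (x y : T) (p : seq T) : Prop :=
  [/\ path e x p, last x p = y, uniq (x :: p) & x :: p =i V].

Definition pd_vertices (n : nat) : pred nat := [pred v | 1 <= v <= n].

(* [`|u - v|] is the distance |u - v| of [ssrint], not truncated subtraction. *)
Definition pd_adj (n : nat) : rel nat :=
  [rel u v | [&& u \in pd_vertices n, v \in pd_vertices n & prime `|u - v|]].

Definition feasible (n n1 n2 : nat) : Prop :=
  exists p : seq nat, hamilton_path (pd_vertices n) (pd_adj n) n1 n2 p.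

(* Main.v *)
Require Import Defs.
From mathcomp Require Import all_boot all_order all_algebra.

(** Whether a given finite graph has a Hamilton path with given ends can be
decided by exhaustive search: from the current vertex, move to an adjacent
vertex that is still unvisited, and backtrack when this is impossible. Lemma
[ham_searchP] says that such a search is sound and complete, for an arbitrary
relation and an arbitrary list of vertices left to visit. Lemma [feasibleP]
applies it to the prime difference graphs. The theorem concerns four values of
[n], hence finitely many pairs of ends, and running the search on each of them
separates the feasible pairs from the exceptional ones. *)

Section HamiltonSearch.

Variables (T : eqType) (e : rel T).

(** [k] is the number of vertices left, so that the recursion is structural;
it is meaningful when [k = size s]. *)
Fixpoint ham_search (k : nat) (x y : T) (s : seq T) : bool :=
  if k is k'.+1 then has (fun z => e x z && ham_search k' z y (rem z s)) s
  else x == y.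

(** The vertices left form a multiset, of which [rem] takes one copy away; this
makes the induction go through for every list [s], with repetitions or not. *)
Lemma ham_searchP k x y s : size s = k ->
  reflect (exists p, [/\ path e x p, last x p = y & perm_eq p s])
          (ham_search k x y s).
Proof.
elim: k x s => [|k IHk] x s /=.
  move/size0nil=> ->; apply: (iffP eqP) => [<-|[p [_ <- /perm_nilP ->]]] //.
  by exists [::].
move=> size_s.
have size_rem_s z : z \in s -> size (rem z s) = k.
  by move=> s_z; rewrite size_rem // size_s.
apply: (iffP hasP) => [[z s_z /andP[e_xz]] | [p []]].
  case/(IHk _ _ (size_rem_s z s_z)) => p [e_zp last_p perm_p].
  exists (z :: p); split; rewrite /= ?e_xz //.
  by rewrite perm_sym (perm_trans (perm_to_rem s_z)) // perm_cons perm_sym.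
case: p => [|z p] /=; first by move=> _ _ /perm_size; rewrite size_s.
case/andP=> e_xz e_zp last_p perm_p.
have s_z : z \in s by rewrite -(perm_mem perm_p) mem_head.
exists z; rewrite ?e_xz //=; apply/(IHk _ _ (size_rem_s z s_z)).
exists p; split=> //.
by rewrite -(perm_cons z) (perm_trans perm_p) ?perm_to_rem.
Qed.

(** To visit every vertex exactly once is to list the vertices in some order, so
the two conditions of [hamilton_path] on [x :: p] amount to one permutation
condition, which has the form that the search decides. *)
Lemma hamilton_path_perm (V : pred T) x y p s :
    uniq s -> s =i V -> x \in s ->
  hamilton_path V e x y p <->
  [/\ path e x p, last x p = y & perm_eq p (rem x s)].
Proof.
move=> uniq_s sV s_x.
have perm_xp : perm_eq (x :: p) s = perm_eq p (rem x s).
  by rewrite (permPr (perm_to_rem s_x)) perm_cons.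
split=> [[e_p last_p uniq_p pV]|[e_p last_p]].
  split=> //; rewrite -perm_xp; apply: uniq_perm => // z.
  by rewrite pV sV.
rewrite -perm_xp => perm_p; split=> //; first by rewrite (perm_uniq perm_p).
by move=> z; rewrite (perm_mem perm_p) sV.
Qed.

End HamiltonSearch.

Definition feasibleb (n n1 n2 : nat) : bool :=
  ham_search _ (pd_adj n) n.-1 n1 n2 (rem n1 (iota 1 n)).

Lemma feasibleP n n1 n2 : 1 <= n1 <= n ->
  reflect (feasible n n1 n2) (feasibleb n n1 n2).
Proof.
move=> n1_bounds.
have iotaV : iota 1 n =i pd_vertices n by move=> v; rewrite mem_iota add1n ltnS.
have iota_n1 : n1 \in iota 1 n by rewrite iotaV.
have pathE p := hamilton_path_perm _ _ _ _ n2 p _ (iota_uniq 1 n) iotaV iota_n1.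
have size_rem_iota : size (rem n1 (iota 1 n)) = n.-1.
  by rewrite size_rem // size_iota.
by apply: (iffP (ham_searchP _ _ _ _ _ _ size_rem_iota)) => -[p /pathE]; exists p.
Qed.

Definition exceptional (n n1 n2 : nat) : bool :=
  [|| (n == 5) &&
        ((n1, n2) \in [:: (1, 2); (2, 3); (3, 4); (4, 5); (1, 5)]),
      (n == 6) && ((n1, n2) \in [:: (2, 3); (3, 4); (4, 5)]),
      (n == 7) && ((n1, n2) \in [:: (3, 4); (4, 5)])
    | (n == 8) && ((n1, n2) == (4, 5))].

Lemma feasibleb_exceptional n n1 n2 :
    1 <= n1 -> n1 < n2 -> n2 <= n -> 5 <= n <= 8 ->
  feasibleb n n1 n2 = ~~ exceptional n n1 n2.
Proof.
move=> n1_gt0 n12 n2n /andP[n_ge5 n_le8].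
have /allP all_n : all (fun n => all (fun n2 => all (fun n1 =>
    feasibleb n n1 n2 == ~~ exceptional n n1 n2)
  (iota 1 n2.-1)) (iota 1 n)) (iota 5 4) by vm_compute.
have /all_n/allP all_n2 : n \in iota 5 4 by rewrite mem_iota n_ge5.
have n2_gt0 : 0 < n2 by apply: leq_trans n12.
have /all_n2/allP all_n1 : n2 \in iota 1 n by rewrite mem_iota n2_gt0.
by apply/eqP/all_n1; rewrite mem_iota n1_gt0 add1n prednK.
Qed.

Theorem lemma2p5 (n n1 n2 : nat)
    (hn1 : 1 <= n1) (hn12 : n1 < n2) (hn2 : n2 <= n) (hn : 5 <= n <= 8) :
  feasible n n1 n2 <->
  ~ [\/ n = 5 /\ (n1, n2) \in [:: (1, 2); (2, 3); (3, 4); (4, 5); (1, 5)],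
        n = 6 /\ (n1, n2) \in [:: (2, 3); (3, 4); (4, 5)],
        n = 7 /\ (n1, n2) \in [:: (3, 4); (4, 5)]
      | n = 8 /\ (n1, n2) = (4, 5)].
Proof.
have n1_bounds : 1 <= n1 <= n by rewrite hn1 (leq_trans (ltnW hn12)).
apply: (iff_trans (rwP (feasibleP n n1 n2 n1_bounds))).
rewrite feasibleb_exceptional //.
have exceptionalP : reflect
  [\/ n = 5 /\ (n1, n2) \in [:: (1, 2); (2, 3); (3, 4); (4, 5); (1, 5)],
      n = 6 /\ (n1, n2) \in [:: (2, 3); (3, 4); (4, 5)],
      n = 7 /\ (n1, n2) \in [:: (3, 4); (4, 5)]
    | n = 8 /\ (n1, n2) = (4, 5)] (exceptional n n1 n2).
  apply: (iffP or4P) => -[].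
  - by case/andP=> /eqP; constructor 1.
  - by case/andP=> /eqP; constructor 2.
  - by case/andP=> /eqP; constructor 3.
  - by case/andP=> /eqP ? /eqP; constructor 4.
  - by case=> -> ?; constructor 1.
  - by case=> -> ?; constructor 2.
  - by case=> -> ?; constructor 3.
  - by case=> -> ->; constructor 4.
by split=> [/exceptionalP|/exceptionalP].
Qed.
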